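(* Let $X$ be a Banach space. For $z \in S_X$ and $t \in (0,1]$ let $A_{t,z} = B_X \cap B[z,t]$ and let $r_{t,z} = r(A_{t,z})$ denote the Chebyshev radius of $A_{t,z}$. Then the following three conditions are equivalent: (i) $X$ is a CCNF space; (ii) for every $z \in S_X$ and every $t \in (0,1]$, the inequality $r_{t,z} < t$ holds; (iii) for every $\varepsilon \in (0,1]$ there is a $t_0 \in (0,\varepsilon)$ such that for every $z \in S_X$ and every $t \in (0,t_0]$ the inequality $r_{t,z} < t$ holds.
   Context: For a Banach space $X$: $B_X = \{x \in X : \|x\| \le 1\}$, $S_X = \{x \in X : \|x\| = 1\}$, and $B[z,t] = \{y \in X : \|z-y\| \le t\}$. For a nonempty bounded set $A \subseteq X$ and $x \in X$, put $r(x,A) = \sup_{a \in A}\|x-a\|$ and $F(x,A) = \{a \in A : \|x-a\| = r(x,A)\}$ (the set of points of $A$ farthest from $x$), and let $\mathrm{Far}\,A = \bigcup_{x \in X} F(x,A)$. The Chebyshev radius of $A$ is $r(A) = \inf_{x \in X} r(x,A)$; a point $c \in X$ with $r(c,A) = r(A)$ is called a Chebyshev center of $A$. A set is nontrivial if it has at least two elements. A nonempty bounded set $A$ is a CCF set if some Chebyshev center of $A$ belongs to $\mathrm{Far}\,A$, and a CCNF set otherwise. The space $X$ is CCF if it contains a nontrivial bounded CCF set; $X$ is CCNF if it is not CCF, i.e. if all nontrivial bounded subsets of $X$ are CCNF sets. *)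

(* Defs.v *)
From HB Require Import structures.
From mathcomp Require Import all_boot all_order all_algebra.
From mathcomp Require Import all_classical all_reals all_analysis.

Set Implicit Arguments.
Unset Strict Implicit.
Unset Printing Implicit Defensive.

Import Order.TTheory GRing.Theory Num.Theory.
Import numFieldNormedType.Exports.

Local Open Scope classical_set_scope.
Local Open Scope ring_scope.

Section ChebyshevCentersFarthestPoints.
Context {R : realType} {X : normedModType R}.
Implicit Types (A : set X) (x c z : X) (t : R).

Definition unit_ball : set X := [set x | `|x| <= 1].

Definition unit_sphere : set X := [set x | `|x| = 1].

(* r(x,A); meaningful for A nonempty and bounded, since [sup] is 0 on sets
   that are empty or not bounded above. *)
Definition far_dist x A : R := sup [set `|x - a| | a in A].

Definition farthest x A : set X := [set a | A a /\ `|x - a| = far_dist x A].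

Definition Far A : set X := \bigcup_(x in [set: X]) farthest x A.

Definition chebyshev_radius A : R := inf (range (fun x => far_dist x A)).

Definition chebyshev_center A c : Prop := far_dist c A = chebyshev_radius A.

Definition nontrivial A : Prop := exists a b, [/\ A a, A b & a <> b].

Definition CCF_set A : Prop :=
  [/\ A !=set0, bounded_set A & exists c, chebyshev_center A c /\ Far A c].

(* B[z,t] is [closed_ball_ Num.norm z t]; the library's [closed_ball z t] is the
   closure of the open ball instead. *)
Definition lens t z : set X := unit_ball `&` closed_ball_ Num.norm z t.

Definition lens_radius t z : R := chebyshev_radius (lens t z).

End ChebyshevCentersFarthestPoints.

Arguments unit_ball {R} X.
Arguments unit_sphere {R} X.

Definition CCF_space (R : realType) (X : normedModType R) : Prop :=
  exists A : set X, [/\ nontrivial A, bounded_set A & CCF_set A].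

Definition CCNF_space (R : realType) (X : normedModType R) : Prop :=
  ~ CCF_space X.

(* Main.v *)
(* A point [c] of [A] that is farthest from some [x] and also a Chebyshev center
   of [A] becomes, after translating and rescaling so that [x = 0] and
   [|c - x| = 1], the center [z] of a lens of size [t = r(A) / |c - x| <= 1]
   containing [A]; a lens of Chebyshev radius [< t] would then make [r(A)]
   smaller than itself.  Conversely [z] is itself a farthest point, from [0], of
   its lens.  Small lenses control large ones by a homothety centered at [z]. *)
Require Import Defs.
From HB Require Import structures.
From mathcomp Require Import all_boot all_order all_algebra.
From mathcomp Require Import all_classical all_reals all_analysis.
From mathcomp Require Import lra.

Set Implicit Arguments.
Unset Strict Implicit.
Unset Printing Implicit Defensive.

Import Order.TTheory GRing.Theory Num.Theory.
Import numFieldNormedType.Exports.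

Local Open Scope classical_set_scope.
Local Open Scope ring_scope.

Section ChebyshevRadius.
Context {R : realType} {X : normedModType R}.
Implicit Types (A : set X) (x y z a b c : X) (r s t : R).

Lemma bounded_setP A :
  bounded_set A <-> exists M : R, forall a, A a -> `|a| <= M.
Proof.
split=> [/pinfty_ex_gt0[M _ AM]|[M AM]]; first by exists M.
exists M; split; first exact: num_real.
by move=> N MN a Aa; exact: le_trans (AM _ Aa) (ltW MN).
Qed.

Lemma dist_le_far_dist A x a : bounded_set A -> A a -> `|x - a| <= far_dist x A.
Proof.
move=> /bounded_setP[M AM] Aa; apply: ub_le_sup; last by exists a.
exists (`|x| + M) => _ [b Ab <-].
by rewrite (le_trans (ler_normB _ _))// lerD2l; exact: AM.
Qed.

Lemma far_dist_le A x s :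
  A !=set0 -> (forall a, A a -> `|x - a| <= s) -> far_dist x A <= s.
Proof.
move=> [a Aa] As; apply: ge_sup; first by exists `|x - a|, a.
by move=> _ [b Ab <-]; exact: As.
Qed.

Lemma chebyshev_radius_le A x :
  A !=set0 -> bounded_set A -> chebyshev_radius A <= far_dist x A.
Proof.
move=> [a Aa] bA; apply: ge_inf; last by exists x.
by exists 0 => _ [y _ <-]; rewrite (le_trans _ (dist_le_far_dist y bA Aa)).
Qed.

(** Trades the infimum for a witness, a ball of radius [s < t] covering [A], which can then be
    transported by affine maps. *)
Lemma chebyshev_radius_ltP A t : A !=set0 -> bounded_set A ->
  chebyshev_radius A < t <->
  exists y, exists2 s, s < t & forall a, A a -> `|y - a| <= s.
Proof.
move=> A0 bA; split=> [|[y [s st ys]]].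
  have ne : range (fun x => far_dist x A) !=set0 by exists (far_dist 0 A), 0.
  move=> /(inf_lt ne)[_ [y _ <-] yt].
  by exists y, (far_dist y A) => // a; exact: dist_le_far_dist.
exact: le_lt_trans (chebyshev_radius_le y A0 bA)
  (le_lt_trans (far_dist_le A0 ys) st).
Qed.

(** By the triangle inequality through any [x], two points [a], [b] of [A] force [far_dist x A] to
    be at least [|a - b| / 2]. *)
Lemma chebyshev_radius_gt0 A : bounded_set A -> nontrivial A ->
  0 < chebyshev_radius A.
Proof.
move=> bA [a [b [Aa Ab ab]]].
have ab0 : 0 < `|a - b| by rewrite normr_gt0 subr_eq0; exact/eqP.
apply: (@lt_le_trans _ _ (`|a - b| / 2)); first by rewrite divr_gt0.
apply: lb_le_inf; first by exists (far_dist 0 A), 0.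
move=> _ [x _ <-]; rewrite ler_pdivrMr//.
have -> : a - b = (x - b) - (x - a) by rewrite opprB [RHS]addrC addrA subrK.
rewrite (le_trans (ler_normB _ _))// mulr_natr mulr2n.
by rewrite lerD// dist_le_far_dist.
Qed.

Lemma bounded_lens t z : bounded_set (lens t z).
Proof. by apply/bounded_setP; exists 1 => a []. Qed.

Lemma lens_center t z : unit_sphere X z -> 0 <= t -> lens t z z.
Proof.
move=> z1 t0; split; first by rewrite /unit_ball/= z1.
by rewrite /closed_ball_/= subrr normr0.
Qed.

Lemma lens_radius_ltP t z : unit_sphere X z -> 0 <= t ->
  lens_radius t z < t <->
  exists y, exists2 s, s < t & forall a, lens t z a -> `|y - a| <= s.
Proof.
move=> z1 t0; apply: chebyshev_radius_ltP; last exact: bounded_lens.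
by exists z; exact: lens_center.
Qed.

Lemma CCF_lens t z : unit_sphere X z -> 0 < t <= 1 ->
  t <= lens_radius t z -> CCF_space X.
Proof.
move=> z1 /andP[t0 t1] tr.
have bL := bounded_lens t z; have Lz := lens_center z1 (ltW t0).
have L0 : lens t z !=set0 by exists z.
exists (lens t z); split=> //.
  (* The second point lies on the segment from [z] to the origin, at distance exactly [t > 0] from
     [z]; [t <= 1] gives it norm [1 - t]. *)
  exists z, ((1 - t) *: z); split=> //.
    split; first by rewrite /unit_ball/= normrZ z1 mulr1 ger0_norm; lra.
    rewrite /closed_ball_/= scalerBl scale1r opprB addrCA subrr addr0.
    by rewrite normrZ z1 mulr1 ger0_norm// ltW.
  move=> /eqP; rewrite scalerBl scale1r -subr_eq0 opprB addrCA subrr addr0.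
  by rewrite -normr_eq0 normrZ z1 mulr1 normr_eq0 gt_eqF.
split=> //; exists z; split.
  (* [z] is a Chebyshev center: its lens stays within distance [t] of it, and [t] is at most the
     radius. *)
  apply/le_anti/andP; split; last exact: chebyshev_radius_le.
  by apply: le_trans tr; apply: far_dist_le => // a [].
exists 0 => //; split=> //.
apply/le_anti/andP; split; first exact: dist_le_far_dist.
apply: far_dist_le => // a [a1 _].
by rewrite !sub0r !normrN z1.
Qed.

Lemma CCNF_lens : (forall z t, unit_sphere X z -> 0 < t <= 1 ->
  lens_radius t z < t) -> CCNF_space X.
Proof.
move=> H [A [ntA bA [A0 _ [c [cc [x _ [Ac xc]]]]]]].
have r0 := chebyshev_radius_gt0 bA ntA.
have rrho := chebyshev_radius_le x A0 bA.
set r := chebyshev_radius A in r0 rrho; set rho := far_dist x A in xc rrho.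
have rho0 : 0 < rho := lt_le_trans r0 rrho.
(* Image of [c] under the map sending [b] to [(b - x) / rho]; it has norm 1 because [c] is farthest
   from [x]. *)
pose z := rho^-1 *: (c - x).
have nV b : `|rho^-1 *: b| = `|b| / rho.
  by rewrite normrZ ger0_norm ?invr_ge0 ?ltW// mulrC.
have z1 : unit_sphere X z.
  by rewrite /unit_sphere/= nV distrC xc divff// gt_eqF.
have t0 : 0 < r / rho by rewrite divr_gt0.
have t1 : 0 < r / rho <= 1 by rewrite t0 ler_pdivrMr// mul1r.
have /(lens_radius_ltP z1 (ltW t0))[y [s st ys]] := H _ _ z1 t1.
have : r < r; last by rewrite ltxx.
apply/(chebyshev_radius_ltP _ A0 bA).
(* The ball covering the lens is pulled back by the inverse map; [s < r / rho] makes its radius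
   smaller than [r]. *)
exists (x + rho *: y), (s * rho); first by rewrite -ltr_pdivlMr.
move=> a Aa; rewrite -ler_pdivrMr// -nV.
have -> : rho^-1 *: (x + rho *: y - a) = y - rho^-1 *: (a - x).
  by rewrite addrAC scalerDr scalerK ?gt_eqF// [LHS]addrC -scalerN opprB.
(* The image of [a] is in the unit ball since [|x - a| <= rho], and near [z] since [c] is a
   Chebyshev center, so [|c - a| <= r]. *)
apply: ys; split.
  by rewrite /unit_ball/= nV distrC ler_pdivrMr// mul1r dist_le_far_dist.
rewrite /closed_ball_/= -scalerBr opprB addrA subrK nV.
by rewrite ler_pM2r ?invr_gt0// /r -cc dist_le_far_dist.
Qed.

(* The homothety of center [z] and ratio [s / t] maps [lens t z] into
   [lens s z], because [unit_ball X] is convex. *)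
Lemma lens_radius_lt_le s t z : unit_sphere X z -> 0 < s <= t ->
  lens_radius s z < s -> lens_radius t z < t.
Proof.
move=> z1 /andP[s0 st]; have t0 : 0 < t := lt_le_trans s0 st.
move=> /(lens_radius_ltP z1 (ltW s0))[y [q qs yq]].
apply/(lens_radius_ltP z1 (ltW t0)).
pose l := s / t; have l0 : 0 < l by rewrite divr_gt0.
have l1 : l <= 1 by rewrite ler_pdivrMr// mul1r.
have lts : l * t = s by rewrite divfK// gt_eqF.
(* The inverse homothety, of ratio [l^-1], applied to the ball of center [y] and radius [q];
   [q < s = l * t] gives [q / l < t]. *)
clearbody l; exists (z + l^-1 *: (y - z)), (q / l).
  by rewrite ltr_pdivrMr// mulrC lts.
move=> a [a1 az]; rewrite ler_pdivlMr// mulrC.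
rewrite -[X in X * _](gtr0_norm l0) -normrZ.
have -> : l *: (z + l^-1 *: (y - z) - a) = y - (z + l *: (a - z)).
  rewrite addrAC scalerDr scalerA divff ?gt_eqF// scale1r [LHS]addrC.
  by rewrite -(opprB a z) scalerN opprD addrA.
apply: yq; split.
  (* Rewritten as the convex combination [(1 - l) *: z + l *: a]. *)
  rewrite /unit_ball/= scalerBr addrCA -{1}(scale1r z) -scalerBl.
  rewrite (le_trans (ler_normD _ _))// !normrZ z1 mulr1.
  rewrite (ger0_norm (ltW l0)) ger0_norm ?subr_ge0//.
  by rewrite -lerBrDr opprB addrCA subrr addr0 ler_piMr// ltW.
rewrite /closed_ball_/= opprD addrA subrr sub0r normrN normrZ gtr0_norm//.
rewrite distrC (le_trans (ler_wpM2l (ltW l0) az))//.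
by rewrite lts.
Qed.

End ChebyshevRadius.

Theorem theorem2p3 (R : realType) (X : completeNormedModType R) :
  (CCNF_space X <->
    (forall (z : X) (t : R), unit_sphere X z -> 0 < t <= 1 ->
      lens_radius t z < t))
  /\
  ((forall (z : X) (t : R), unit_sphere X z -> 0 < t <= 1 ->
      lens_radius t z < t) <->
    (forall eps : R, 0 < eps <= 1 ->
      exists t0 : R, 0 < t0 < eps /\
        forall (z : X) (t : R), unit_sphere X z -> 0 < t <= t0 ->
          lens_radius t z < t)).
Proof.
split; split.
- move=> ccnf z t z1 t01; rewrite ltNge; apply/negP => tr.
  exact: ccnf (CCF_lens z1 t01 tr).
- exact: CCNF_lens.
- move=> H eps /andP[e0 e1]; exists (eps / 2); split; first by lra.
  by move=> z t z1 /andP[t0 te]; apply: H => //; lra.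
- move=> H z t z1 /andP[t0 t1].
  (* A single threshold [s], obtained for [eps = 1], is enough: sizes up to [s] are direct, larger
     ones reduce to size [s] by homothety. *)
  have [|s [/andP[s0 _] Hs]] := H 1; first by rewrite ltr01 lexx.
  have [ts|/ltW st] := leP t s; first by apply: Hs; rewrite // t0.
  by apply: (lens_radius_lt_le z1 _ (Hs z s z1 _)); rewrite s0 /=.
Qed.
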